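(* Let $D$ be a complete data set (no missing values) of $N$ samples of a vector of discrete random variables $X=(X_1,\dots,X_n)$, each with finitely many states. Let $G^+$ and $G^-$ be two directed acyclic graphs on the variables that are identical except for the edge $A \leftarrow B$, which is present in $G^+$ and absent in $G^-$; let $\Pi$ be the set of parents of $A$ in $G^-$ (so that the parents of $A$ in $G^+$ are $\Pi\cup\{B\}$). Let $p(D|\alpha,G)$ be the marginal likelihood of the graph $G$ under the BDeu score with equivalent sample size (ESS) $\alpha>0$. Then, given the BDeu score, the leading-order approximation of the (log) Bayes factor of the two graphs $G^+$ and $G^-$ reads, for large ESS-values ($\alpha \gg N$), $$\log\frac{p(D|\alpha,G^+)}{p(D|\alpha,G^-)} = \frac{N}{2\alpha}\Big\{ N\cdot U(\hat p(A,B|\Pi)) - d_F \Big\} + \mathcal{O}\big(N^2/\alpha^2\big),$$ where $U$ is the uniformity measure, $\hat p(A,B|\Pi)$ is the empirical distribution implied by the data, i.e. $\hat p(a,b|\pi)=N_{a,b,\pi}/N_\pi$ (and $\hat p(a,b,\pi)=N_{a,b,\pi}/N$), and $d_F = |\Pi|\,(|A|-1)(|B|-1)$ are the degrees of freedom (not corrected for zero cell counts).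
   Context: $|\cdot|$ denotes the number of (joint) states of the variable(s), so $|A,B,\Pi| = |A|\cdot|B|\cdot|\Pi|$, etc. (with $|\Pi|=1$ if $\Pi$ is empty). For a set of variables $Y$ with joint state $y$, $N_y$ is the number of samples in $D$ with $Y=y$. BDeu marginal likelihood: for a directed acyclic graph $G$ in which $X_i$ has parent set $\Pi_i$, with states $x_i$ of $X_i$ and joint states $\pi_i$ of $\Pi_i$, $$p(D|\alpha,G)=\prod_{i=1}^n\prod_{\pi_i}\frac{\Gamma(\alpha_{\pi_i})}{\Gamma(N_{\pi_i}+\alpha_{\pi_i})}\prod_{x_i}\frac{\Gamma(N_{x_i,\pi_i}+\alpha_{x_i,\pi_i})}{\Gamma(\alpha_{x_i,\pi_i})},$$ $$\alpha_{x_i,\pi_i}=\frac{\alpha}{|X_i|\cdot|\Pi_i|},\qquad \alpha_{\pi_i}=\sum_{x_i}\alpha_{x_i,\pi_i}=\frac{\alpha}{|\Pi_i|}.$$ Uniformity measure: for a joint distribution $p$ of $(A,B,\Pi)$, with marginals $p(a,\pi)$, $p(b,\pi)$, $p(\pi)$, $$U(p(A,B|\Pi)) = \sum_{a,b,\pi} p(a,b,\pi)\Big(|A,B,\Pi|\cdot p(a,b,\pi) - |A,\Pi|\cdot p(a,\pi) - |B,\Pi|\cdot p(b,\pi) + |\Pi|\cdot p(\pi)\Big).$$ *)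

(* Defs.v *)
From HB Require Import structures.
From mathcomp Require Import all_boot all_order all_algebra.
From mathcomp Require Import all_classical all_reals all_analysis.

Set Implicit Arguments.
Unset Strict Implicit.
Unset Printing Implicit Defensive.

Import Order.TTheory GRing.Theory Num.Theory.
Import numFieldNormedType.Exports.

Local Open Scope ring_scope.

(* Euler's integral of the second kind; only meaningful for 0 < x. *)
Definition Gamma (R : realType) (x : R) : R :=
  \int[lebesgue_measure]_(t in `]0, +oo[%classic) (t `^ (x - 1) * expR (- t)).

(* In a graph G on the variables, [G i j] means that there is an edge i -> j. *)
Definition acyclic (V : finType) (G : rel V) : Prop :=
  forall c : seq V, cycle G c -> c = [::].

Definition parents (V : finType) (G : rel V) (i : V) : {set V} :=
  [set j | G j i].

Section Data.
Variables (n : nat) (Omega : 'I_n -> finType).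

Definition sample : finType := {dffun forall i : 'I_n, Omega i}.

(* Joint states of the variables in Y; there is exactly one when Y is empty. *)
Definition states (Y : {set 'I_n}) : finType :=
  {dffun forall j : {j : 'I_n | j \in Y}, Omega (val j)}.

Definition restr (Y : {set 'I_n}) (s : sample) : states Y :=
  [ffun j : {j : 'I_n | j \in Y} => s (val j)].

Variables (N : nat) (D : 'I_N -> sample).

(* Number of samples in which the statistic f takes the value y. *)
Definition count_data (T : eqType) (f : sample -> T) (y : T) : nat :=
  #|[set k : 'I_N | f (D k) == y]|.

Variable R : realType.

Definition bdeu_joint (alpha : R) (G : rel 'I_n) (i : 'I_n) : R :=
  alpha / (#|Omega i|%:R * #|states (parents G i)|%:R).

Definition bdeu_parent (alpha : R) (G : rel 'I_n) (i : 'I_n) : R :=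
  alpha / #|states (parents G i)|%:R.

Definition marginal_likelihood (alpha : R) (G : rel 'I_n) : R :=
  \prod_(i < n) \prod_(pi : states (parents G i))
    (Gamma (bdeu_parent alpha G i) /
       Gamma ((count_data (restr (parents G i)) pi)%:R + bdeu_parent alpha G i) *
     \prod_(x : Omega i)
       (Gamma ((count_data (fun s => (s i, restr (parents G i) s)) (x, pi))%:R
               + bdeu_joint alpha G i) /
        Gamma (bdeu_joint alpha G i))).

Definition empirical (A B : 'I_n) (Pi : {set 'I_n})
    (a : Omega A) (b : Omega B) (pi : states Pi) : R :=
  (count_data (fun s => (s A, s B, restr Pi s)) (a, b, pi))%:R / N%:R.

End Data.

Definition uniformity (R : realType) (TA TB TP : finType)
    (p : TA -> TB -> TP -> R) : R :=
  let pAP a pi := \sum_(b : TB) p a b pi in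
  let pBP b pi := \sum_(a : TA) p a b pi in
  let pP pi := \sum_(a : TA) \sum_(b : TB) p a b pi in
  \sum_(a : TA) \sum_(b : TB) \sum_(pi : TP)
    p a b pi * ((#|TA| * #|TB| * #|TP|)%:R * p a b pi
                - (#|TA| * #|TP|)%:R * pAP a pi
                - (#|TB| * #|TP|)%:R * pBP b pi
                + #|TP|%:R * pP pi).

Definition deg_freedom (R : realType) (TA TB TP : finType) : R :=
  #|TP|%:R * (#|TA|%:R - 1) * (#|TB|%:R - 1).

(* Main.v *)
Require Import Defs.
From mathcomp Require Import all_boot all_order all_algebra.
From mathcomp Require Import all_classical all_reals all_analysis.
From mathcomp Require Import measurable_realfun ring lra.
Import Order.TTheory GRing.Theory Num.Theory.
Import numFieldNormedType.Exports.
Local Open Scope ring_scope.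

(* All factors of the two likelihoods except that of A agree and cancel. The
   factor of A is a quotient of two products over the values t of a statistic
   of Gamma(N_t + a) / Gamma(a), where a = alpha / (number of values). By the
   functional equation this is the rising product a (a + 1) ... (a + N_t - 1),
   and ln (1 + j/a) = j/a + O(1/a^2) gives
     N_t ln a + (N_t^2 - N_t) / (2 a) + O(N_t^3 / a^2).
   Summing over t, the logarithms cancel between the four statistics (A,B,Pi),
   (B,Pi), (A,Pi), Pi, the squares add up to N^2 U, and the linear terms to
   - N d_F. As alpha tends to infinity, only arguments of Gamma larger than 1
   matter, where the integrand is continuous at 0. *)

Set Implicit Arguments.
Unset Strict Implicit.
Unset Printing Implicit Defensive.

(** * Euler's integral at arguments above 1: integrability, functional equation, positivity *)

Section GammaFunction.
Local Open Scope classical_set_scope.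
Variable R : realType.
Local Notation mu := (@lebesgue_measure R).
Implicit Types (x y t : R).

(** The integrand of Gamma at [y + 1]; with this shift, arguments above 1 become exponents
    [y > 0]. *)
Definition gamma_kernel y t : R := t `^ y * expR (- t).

Lemma gamma_kernel_ge0 y t : 0 <= gamma_kernel y t.
Proof. by rewrite mulr_ge0 ?powR_ge0 ?expR_ge0. Qed.

(** From [1 + s <= expR s] at [s = t / (2 * y)], [t] is at most [2 * y * expR (t / (2 * y))].
    Raising to the power [y] costs only half of the exponential decay; the other half gives both
    integrability and the limit at infinity. *)
Lemma gamma_kernel_bound y t : 0 < y -> 0 <= t ->
  gamma_kernel y t <= (2 * y) `^ y * expR (- (2^-1 * t)).
Proof.
move=> y0 t0; have y20 : 0 < 2 * y by rewrite mulr_gt0.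
have -> : expR (- (2^-1 * t)) = expR (2^-1 * t) * expR (- t).
  by rewrite -expRD; congr expR; lra.
rewrite /gamma_kernel mulrA ler_wpM2r ?expR_ge0//.
have -> : expR (2^-1 * t) = expR (t / (2 * y)) `^ y.
  by rewrite -expRM; congr expR; field; rewrite gt_eqF.
rewrite -powRM ?expR_ge0 ?(ltW y20)// ge0_ler_powR ?nnegrE ?mulr_ge0 ?expR_ge0 ?(ltW y0)//.
rewrite mulrC -ler_pdivrMr//.
by rewrite (le_trans _ (expR_ge1Dx _))// lerDr.
Qed.

Lemma gamma_kernel_cvg0 y : 0 < y -> gamma_kernel y t @[t --> +oo] --> 0.
Proof.
move=> y0.
apply: (@squeeze_cvgr _ _ _ _ (fun=> 0) (fun t => (2 * y) `^ y * expR (- (2^-1 * t)))).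
- near=> t; rewrite gamma_kernel_ge0 gamma_kernel_bound//.
- exact: cvg_cst.
- rewrite -[X in _ --> X](mulr0 ((2 * y) `^ y)); apply: cvgMr.
  apply: (@cvg_comp _ _ _ (fun t => 2^-1 * t) (fun z => expR (- z)) _
    (pinfty_nbhs R)); last exact: cvgr_expR.
  exact: gt0_cvgMry.
Unshelve. all: by end_near. Qed.

Lemma is_derive_gamma_kernel y t : 0 < t ->
  is_derive t 1 (gamma_kernel y)
    (y * gamma_kernel (y - 1) t - gamma_kernel y t).
Proof.
move=> t0; have d1 := is_derive1_powR y t0.
have d2 : is_derive t 1 (fun s => expR (- s)) (- expR (- t)).
  by apply: is_derive_eq; rewrite /GRing.scale/=; ring.
apply: (is_derive_eq (is_deriveM d1 d2)).
by rewrite /gamma_kernel /GRing.scale/=; ring.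
Qed.

Lemma gamma_kernel_continuous y : 0 < y ->
  {within `[0, +oo[%classic, continuous (gamma_kernel y)}.
Proof.
move=> y0; apply/continuous_within_itvcyP; split.
  move=> t; rewrite in_itv/= andbT => t0.
  apply/differentiable_continuous/derivable1_diffP.
  by case: (is_derive_gamma_kernel y t0).
rewrite /gamma_kernel; apply: cvgM.
  by rewrite powR0 ?gt_eqF//; exact: powR_cvg0.
apply/cvg_at_right_filter; apply: continuous_comp; last exact: continuous_expR.
exact: (@continuousN _ R^o).
Qed.

Lemma measurable_gamma_kernel y (D : set R) :
  measurable_fun D (gamma_kernel y).
Proof.
apply: measurable_funTS; apply: measurable_funM; first exact: measurable_powR.
by apply: measurableT_comp => //; exact: measurable_expR.
Qed.

Lemma integrable_gamma_kernel y : 0 < y ->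
  mu.-integrable `[0, +oo[%classic (EFin \o gamma_kernel y).
Proof.
move=> y0.
have hI : mu.-integrable `[0, +oo[%classic
    (EFin \o (fun t => 2 * (2 * y) `^ y * exponential_pdf (2^-1) t)).
  apply: (integrableS measurableT) => //.
  under [X in mu.-integrable _ X]eq_fun do rewrite /= EFinM.
  apply: integrableZl => //; exact: integrable_exponential_pdf.
apply: (le_integrable _ _ _ hI) => //.
  by apply/measurable_EFinP; exact: measurable_gamma_kernel.
move=> t /=; rewrite in_itv/= andbT => t0.
rewrite lee_fin ger0_norm ?gamma_kernel_ge0//.
rewrite (le_trans _ (ler_norm _))// (le_trans (gamma_kernel_bound y0 t0))//.
rewrite exponential_pdfE// mulNr -mulrA.
set a := _ `^ _; set b := expR _.
by rewrite (_ : 2 * _ = a * b)//; field.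
Qed.

(** Adding the null point 0 to the domain leaves the integral unchanged and yields the closed
    half-line on which the fundamental theorem of calculus is applied. *)
Lemma Gamma_kernelE x : 1 < x ->
  Gamma x = \int[mu]_(t in `[0, +oo[%classic) gamma_kernel (x - 1) t.
Proof.
move=> x1; rewrite /Gamma Rintegral_itv_obnd_cbnd//.
have := integrable_gamma_kernel (y := x - 1); rewrite subr_gt0 => /(_ x1).
by apply: integrableS => //; apply: subset_itvr; rewrite bnd_simp.
Qed.

(* The derivative of [- t ^ x * exp (- t)] changes sign; a multiple of the
   exponential density is added so that the fundamental theorem of calculus for
   nonnegative integrands on a half-line applies. *)
Lemma GammaD1 x : 1 < x -> Gamma (x + 1) = x * Gamma x.
Proof.
move=> x1; have x0 : 0 < x by rewrite (lt_trans _ x1).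
have x10 : 0 < x - 1 by rewrite subr_gt0.
rewrite !Gamma_kernelE ?addrK//; last lra.
(* [K] is [x] times the constant of [gamma_kernel_bound] at [x - 1]; the extra 2 cancels the rate
   1/2 of the density. Hence [K * e t] dominates [x * gamma_kernel (x - 1) t]. *)
pose K := x * (2 * (2 * (x - 1)) `^ (x - 1)).
pose e := exponential_pdf (2^-1 : R).
have ie : mu.-integrable `[0, +oo[%classic (EFin \o e).
  apply: (integrableS measurableT) => //; exact: integrable_exponential_pdf.
have iK : mu.-integrable `[0, +oo[%classic (EFin \o (fun t => K * e t)).
  under [X in mu.-integrable _ X]eq_fun do rewrite /= EFinM.
  exact: integrableZl.
have ig : mu.-integrable `[0, +oo[%classic
    (EFin \o (fun t => x * gamma_kernel (x - 1) t)).
  under [X in mu.-integrable _ X]eq_fun do rewrite /= EFinM.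
  by apply: integrableZl => //; exact: integrable_gamma_kernel.
have igx := integrable_gamma_kernel x0.
have E1 : \int[mu]_(t in `[0, +oo[%classic) e t = 1.
  (* The density vanishes off the half-line, so its integral there is its total mass. *)
  rewrite Rintegral_mkcond (_ : e \_ _ = e); last first.
    by rewrite /e /exponential_pdf; apply/funext => t; rewrite !patchE; case: ifP => // ->.
  by rewrite /Rintegral integral_exponential_pdf.
pose f t := gamma_kernel x t - x * gamma_kernel (x - 1) t + K * e t.
pose F t := - gamma_kernel x t - K * expR (- 2^-1 * t).
have f_ge0 t : 0 <= t -> 0 <= f t.
  move=> t0; rewrite /f -addrA addr_ge0 ?gamma_kernel_ge0// addrC subr_ge0.
  rewrite /e exponential_pdfE// /K -mulrA ler_wpM2l ?(ltW x0)//.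
  rewrite (le_trans (gamma_kernel_bound x10 t0))// mulNr.
  by rewrite mulrACA divff// mul1r.
have cf : {within `[0, +oo[, continuous f}.
  have /subspace_continuousP c1 := gamma_kernel_continuous x0.
  have /subspace_continuousP c2 := gamma_kernel_continuous x10.
  have /subspace_continuousP c3 : {within `[0, +oo[, continuous e}.
    exact: within_continuous_exponential_pdf.
  apply/subspace_continuousP => t Dt; apply: cvgD; last first.
    by apply: cvgMr; exact: c3.
  by apply: cvgB; [exact: c1 | apply: cvgMr; exact: c2].
have dF t : 0 < t -> is_derive t 1 F (f t).
  move=> t0; have d1 := is_derive_gamma_kernel x t0.
  have d2 : is_derive t 1 (fun s => expR (- 2^-1 * s)) (- 2^-1 * expR (- 2^-1 * t)).
    by apply: is_derive_eq; rewrite /= /GRing.scale/=; ring.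
  have d3 := is_deriveB (is_deriveN d1) (is_deriveZ K d2).
  apply: (is_derive_eq d3).
  by rewrite /f /e exponential_pdfE ?(ltW t0)// /GRing.scale/=; ring.
have ddF t : 0 < t -> derivable F t 1 by move=> t0; case: (dF _ t0).
have Fy : F t @[t --> +oo] --> 0.
  rewrite -[0]subr0 -[X in X - _]oppr0 -[X in _ - X](mulr0 K).
  apply: cvgB; first by apply: cvgN; exact: gamma_kernel_cvg0.
  apply: cvgMr.
  under eq_fun do rewrite mulNr.
  apply: (@cvg_comp _ _ _ (fun t => 2^-1 * t) (fun z => expR (- z)) _
    (pinfty_nbhs R)); last exact: cvgr_expR.
  exact: gt0_cvgMry.
have F0 : F t @[t --> 0^'+] --> F 0.
  have /continuous_within_itvcyP[_ c0] := gamma_kernel_continuous x0.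
  apply: cvgB; first exact: cvgN.
  apply: cvgMr; apply/cvg_at_right_filter.
  apply: continuous_comp; last exact: continuous_expR.
  exact: mulrl_continuous.
have dFE : {in `]0, +oo[%R, F^`() =1 f}.
  move=> t; rewrite in_itv/= andbT => t0.
  by rewrite derive1E; case: (dF _ t0).
(* The integral of [f] is [0 - F 0 = K]. The added density accounts for exactly [K], so the
   remaining difference of kernels integrates to 0. *)
have := Rintegral_ge0_continuous_FTC2y f_ge0 cf Fy ddF F0 dFE.
have -> : F 0 = - K.
  by rewrite /F /gamma_kernel powR0 ?gt_eqF// mul0r oppr0 mulr0 expR0 mulr1 sub0r.
have iB : mu.-integrable `[0, +oo[
    (EFin \o (fun t => gamma_kernel x t - x * gamma_kernel (x - 1) t)).
  under [X in mu.-integrable _ X]eq_fun do rewrite /= EFinB.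
  exact: integrableB.
rewrite /f RintegralD//.
rewrite RintegralB// !RintegralZl//; last exact: integrable_gamma_kernel.
rewrite E1 mulr1 sub0r opprK => EK; apply: subr0_eq.
by apply: (addIr K); rewrite EK add0r.
Qed.

(** On [[1, 2]] the power is at least 1 and the exponential at least [expR (- 2)], so this interval
    alone contributes a positive amount. *)
Lemma Gamma_gt0 x : 1 < x -> 0 < Gamma x.
Proof.
move=> x1; have x10 : 0 < x - 1 by rewrite subr_gt0.
have /integrableP[mk ik] := integrable_gamma_kernel x10.
(* Finiteness has to be shown as well, because [fine] sends an infinite integral to 0. *)
rewrite Gamma_kernelE// /Rintegral fine_gt0//; apply/andP; split; last first.
  apply: le_lt_trans ik; apply: ge0_le_integral => //.
  - by move=> t _; rewrite lee_fin gamma_kernel_ge0.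
  - by apply: measurableT_comp.
  - by move=> t _; rewrite lee_fin ler_norm.
apply: (@lt_le_trans _ _ (\int[mu]_(t in `[1%R, 2%R]) (expR (- 2))%:E)%E).
  rewrite integral_cst// mule_gt0 ?lte_fin ?expR_gt0//.
  have : (0 < mu `[1%R, 2%R])%E.
    rewrite lebesgue_measure_itv/= lte_fin ltr1n -EFinD lte_fin; lra.
  exact.
apply: (@le_trans _ _ (\int[mu]_(t in `[1%R, 2%R]) (gamma_kernel (x - 1) t)%:E)%E).
  apply: ge0_le_integral => //.
  - by apply/measurable_EFinP; exact: measurable_gamma_kernel.
  - move=> t /=; rewrite in_itv/= => /andP[t1 t2].
    rewrite lee_fin -[leLHS]mul1r ler_pM ?expR_ge0//.
      rewrite [leLHS](_ : 1 = 1 `^ (x - 1)); last by rewrite powR1.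
      by rewrite ge0_ler_powR// ?nnegrE ?(ltW x10)// (le_trans _ t1).
    by rewrite ler_expR lerN2.
apply: ge0_subset_integral => //.
- by move=> t _; rewrite lee_fin gamma_kernel_ge0.
- by move=> t /=; rewrite !in_itv/= andbT => /andP[t1 _]; rewrite (le_trans _ t1).
Qed.

Lemma Gamma_rising x (k : nat) : 1 < x ->
  Gamma (k%:R + x) = Gamma x * \prod_(j < k) (x + j%:R).
Proof.
move=> x1; elim: k => [|k IH]; first by rewrite big_ord0 add0r mulr1.
rewrite big_ord_recr/= mulrA -IH -addn1 natrD addrAC GammaD1; last first.
  by rewrite (lt_le_trans x1)// lerDr.
by rewrite mulrC (addrC x).
Qed.

End GammaFunction.

(** * Expansion of the logarithm of a rising product with an explicit remainder *)

Section Asymptotics.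
Variable R : realType.
Implicit Types (a u alpha : R).

Lemma ln1D_linear u : 0 <= u -> `|ln (1 + u) - u| <= u ^+ 2.
Proof.
move=> u0; have u1 : 0 < 1 + u by lra.
have h1 : ln (1 + u) <= u by apply: le_ln1Dx; lra.
(* The upper bound applied to [(1 + u)^-1 = 1 - u / (1 + u)] gives [u / (1 + u) <= ln (1 + u)], and
   the left side is at least [u - u ^+ 2]. *)
have h2 : u - u ^+ 2 <= ln (1 + u).
  have E : 1 + - (u / (1 + u)) = (1 + u)^-1 by field; rewrite gt_eqF.
  have uu : u / (1 + u) < 1 by rewrite ltr_pdivrMr// mul1r; lra.
  have : ln (1 + - (u / (1 + u))) <= - (u / (1 + u)) by apply: le_ln1Dx; lra.
  rewrite E lnV ?posrE// lerN2; apply: le_trans.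
  rewrite ler_pdivlMr// (_ : _ * _ = u - u ^+ 3); last by ring.
  by rewrite gerBl exprn_ge0.
by rewrite ler_norml; apply/andP; split; [lra | have := sqr_ge0 u; lra].
Qed.

Lemma ln_prod (I : finType) (F : I -> R) : (forall i, 0 < F i) ->
  ln (\prod_i F i) = \sum_i ln (F i).
Proof.
move=> F0.
suff [] : 0 < \prod_i F i /\ ln (\prod_i F i) = \sum_i ln (F i) by [].
apply: (big_ind2 (fun x y : R => 0 < x /\ ln x = y)) => //.
  by rewrite ln1.
by move=> x1 y1 x2 y2 [p1 <-] [p2 <-]; rewrite mulr_gt0// lnM.
Qed.

(** Induction on [k]: the new factor [a * (1 + k / a)] adds [ln a + k / a], which is the increment
    of the main term, with error at most [k^2 / a^2]. The remainders add up because
    [k^3 + k^2 <= (k + 1)^3]. *)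
Lemma ln_rising a (k : nat) : 0 < a ->
  `|ln (\prod_(j < k) (a + j%:R)) - k%:R * ln a - (k%:R ^+ 2 - k%:R) / (2 * a)|
    <= k%:R ^+ 3 / a ^+ 2.
Proof.
move=> a0; elim: k => [|k IH].
  by rewrite big_ord0 ln1 expr0n/= !(mul0r, subrr) expr0n mul0r normr0.
have P0 : 0 < \prod_(j < k) (a + j%:R) by apply: prodr_gt0 => j _; rewrite ltr_wpDr.
have ka : 0 <= k%:R / a by rewrite divr_ge0// ltW.
rewrite big_ord_recr/= lnM ?posrE// ?ltr_wpDr//.
have -> : a + k%:R = a * (1 + k%:R / a) by field; rewrite gt_eqF.
rewrite lnM ?posrE ?ltr_wpDr//.
have := ln1D_linear ka.
move: IH; move: (ln _) (ln _) (ln _) => p q r IH H.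
rewrite (_ : r + _ - _ - _ = (r - k%:R * q - (k%:R ^+ 2 - k%:R) / (2 * a))
  + (p - k%:R / a)); last by rewrite -natr1; field; rewrite gt_eqF.
rewrite (le_trans (ler_normD _ _))// (le_trans (lerD IH H))//.
rewrite exprMn exprVn -mulrDl ler_wpM2r ?invr_ge0 ?exprn_ge0 ?(ltW a0)//.
rewrite -natr1 -subr_ge0 (_ : _ - _ = 2 * k%:R ^+ 2 + 3 * k%:R + 1); last by ring.
by rewrite !addr_ge0// mulr_ge0// exprn_ge0.
Qed.

End Asymptotics.

(** * Counts of a statistic, their moments, and the Gamma product attached to them *)

Section CountStatistics.
Variables (R : realType) (n : nat) (Omega : 'I_n -> finType).
Variables (N : nat) (D : 'I_N -> sample Omega).

Lemma count_dataE (T : eqType) (f : sample Omega -> T) (t : T) :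
  count_data D f t = (\sum_(k < N) (f (D k) == t))%N.
Proof.
rewrite /count_data -sum1dep_card big_mkcond/=.
by apply: eq_bigr => k _; case: eqP.
Qed.

Lemma sum_eqop (T : finType) (t : T) : (\sum_(u : T) (t == u) = 1)%N.
Proof.
rewrite (bigD1 t)//= eqxx big1 ?addn0// => u.
by rewrite eq_sym => /negbTE->.
Qed.

Lemma sum_count_data (T : finType) (f : sample Omega -> T) :
  (\sum_(t : T) count_data D f t = N)%N.
Proof.
under eq_bigr do rewrite count_dataE.
rewrite exchange_big/= -[RHS]card_ord -sum1_card.
by apply: eq_bigr => k _; exact: sum_eqop.
Qed.

Lemma count_data_le (T : finType) (f : sample Omega -> T) (t : T) :
  (count_data D f t <= N)%N.
Proof. by rewrite -[leqRHS](sum_count_data f) (bigD1 t)//= leq_addr. Qed.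

(* The sum of squared counts of [f] depends only on which pairs of samples [f]
   identifies, so statistics with different codomains can be compared. *)
Definition coincidences (T : eqType) (f : sample Omega -> T) : nat :=
  (\sum_(k < N) \sum_(l < N) (f (D k) == f (D l)))%N.

(** A squared count counts the ordered pairs of samples that both take the value [t]; summing over
    [t] leaves the pairs whose values agree. *)
Lemma sum_count_data_sqr (T : finType) (f : sample Omega -> T) :
  (\sum_(t : T) count_data D f t ^ 2 = coincidences f)%N.
Proof.
rewrite /coincidences.
transitivity (\sum_(k < N) \sum_(l < N) \sum_(t : T)
    (f (D k) == t) * (f (D l) == t))%N.
  under eq_bigr => t _.
    rewrite expnS expn1 {1}count_dataE big_distrl/=.
    under eq_bigr do rewrite count_dataE big_distrr/=.
    over.
  by rewrite exchange_big/=; apply: eq_bigr => k _; rewrite exchange_big.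
apply: eq_bigr => k _; apply: eq_bigr => l _.
rewrite (bigD1 (f (D k)))//= eqxx mul1n eq_sym big1 ?addn0// => t.
by rewrite eq_sym => /negbTE->.
Qed.

Lemma eq_coincidences (T T' : eqType) (f : sample Omega -> T) (g : sample Omega -> T') :
  (forall s s', (f s == f s') = (g s == g s')) ->
  coincidences f = coincidences g.
Proof. by move=> fg; apply: eq_bigr => k _; apply: eq_bigr => l _; rewrite fg. Qed.

(** The common shape of all BDeu factors: [alpha] is spread evenly over the values of [f], be they
    parent states or joint states of a variable and its parents. *)
Definition gamma_score (alpha : R) (T : finType) (f : sample Omega -> T) : R :=
  \prod_(t : T) (Gamma ((count_data D f t)%:R + alpha / #|T|%:R) /
                 Gamma (alpha / #|T|%:R)).

(** The hypothesis places [alpha / #|T|] above 1, where [Gamma_rising] and [Gamma_gt0] apply. *)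
Lemma gamma_scoreE (alpha : R) (T : finType) (f : sample Omega -> T) :
  #|T|%:R < alpha ->
  gamma_score alpha f =
    \prod_(t : T) \prod_(j < count_data D f t) (alpha / #|T|%:R + j%:R).
Proof.
move=> Ta; apply: eq_bigr => t _.
have a1 : 1 < alpha / #|T|%:R.
  by rewrite ltr_pdivlMr ?mul1r// ltr0n; apply/card_gt0P; exists t.
by rewrite Gamma_rising// mulrAC divff ?mul1r// gt_eqF ?Gamma_gt0.
Qed.

Lemma gamma_score_gt0 (alpha : R) (T : finType) (f : sample Omega -> T) :
  #|T|%:R < alpha -> 0 < gamma_score alpha f.
Proof.
move=> Ta; rewrite gamma_scoreE//; apply: prodr_gt0 => t _; apply: prodr_gt0 => j _.
by rewrite ltr_wpDr// divr_gt0 ?(le_lt_trans _ Ta)// ltr0n; apply/card_gt0P; exists t.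
Qed.

(** [ln_rising] at [a = alpha / #|T|], summed over the values: the counts add up to [N], their
    squares to [coincidences f]. In each cubic remainder two factors are bounded by [N] and the
    third is summed, which gives [N ^ 3] with no further factor [#|T|]. *)
Lemma ln_gamma_score (alpha : R) (T : finType) (f : sample Omega -> T) :
  #|T|%:R < alpha ->
  `|ln (gamma_score alpha f) - N%:R * ln (alpha / #|T|%:R)
    - #|T|%:R / (2 * alpha) * ((coincidences f)%:R - N%:R)|
  <= (#|T|%:R ^+ 2 * N%:R) * (N%:R ^+ 2 / alpha ^+ 2).
Proof.
move=> Ta; have alpha0 : 0 < alpha by rewrite (le_lt_trans _ Ta).
have a0 (t : T) : 0 < alpha / #|T|%:R.
  by rewrite divr_gt0// ltr0n; apply/card_gt0P; exists t.
have Tn0 (t : T) : #|T|%:R != 0 :> R.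
  by rewrite pnatr_eq0 -lt0n; apply/card_gt0P; exists t.
rewrite gamma_scoreE// ln_prod; last first.
  by move=> t; apply: prodr_gt0 => j _; rewrite ltr_wpDr// a0.
have EN : \sum_(t : T) (count_data D f t)%:R = N%:R :> R.
  by rewrite -natr_sum sum_count_data.
have EC : \sum_(t : T) (count_data D f t)%:R ^+ 2 = (coincidences f)%:R :> R.
  by rewrite -sum_count_data_sqr natr_sum; apply: eq_bigr => t _; rewrite natrX.
rewrite [X in `|X|](_ : _ = \sum_(t : T)
    (ln (\prod_(j < count_data D f t) (alpha / #|T|%:R + j%:R))
     - (count_data D f t)%:R * ln (alpha / #|T|%:R)
     - ((count_data D f t)%:R ^+ 2 - (count_data D f t)%:R)
       * (#|T|%:R / (2 * alpha)))); last first.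
  rewrite !sumrB -!mulr_suml sumrB EN EC.
  by congr (_ - _); rewrite mulrC.
rewrite [leRHS](_ : _ = \sum_(t : T) (N%:R ^+ 2 *
   ((count_data D f t)%:R * (#|T|%:R ^+ 2 / alpha ^+ 2)))); last first.
  by rewrite -mulr_sumr -mulr_suml EN; ring.
apply: le_trans (ler_norm_sum _ _ _) _; apply: ler_sum => t _.
have := ln_rising (count_data D f t) (a0 t).
have -> : (count_data D f t)%:R ^+ 3 / (alpha / #|T|%:R) ^+ 2 =
    (count_data D f t)%:R ^+ 2 * ((count_data D f t)%:R * (#|T|%:R ^+ 2 / alpha ^+ 2)) :> R.
  by field; rewrite gt_eqF// (Tn0 t).
have -> : (2 * (alpha / #|T|%:R))^-1 = #|T|%:R / (2 * alpha) :> R.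
  by field; rewrite gt_eqF// (Tn0 t).
move=> /le_trans; apply; rewrite ler_wpM2r//.
  by rewrite mulr_ge0// divr_ge0 ?exprn_ge0 ?(ltW alpha0).
by rewrite lerXn2r ?nnegrE ?ler_nat ?count_data_le.
Qed.

Lemma sum_count_data_mid (TA TB TP : finType) (fA : sample Omega -> TA)
    (fB : sample Omega -> TB) (fP : sample Omega -> TP) (a : TA) (p : TP) :
  (\sum_(b : TB) count_data D (fun s => (fA s, fB s, fP s)) (a, b, p) =
   count_data D (fun s => (fA s, fP s)) (a, p))%N.
Proof.
under eq_bigr do rewrite count_dataE.
rewrite count_dataE exchange_big/=; apply: eq_bigr => k _.
rewrite (bigD1 (fB (D k)))//= !xpair_eqE eqxx andbT big1 ?addn0// => b.
by rewrite !xpair_eqE [fB _ == b]eq_sym => /negbTE->; rewrite andbF.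
Qed.

Lemma sum_count_data_left (TA TB : finType) (fA : sample Omega -> TA)
    (fB : sample Omega -> TB) (b : TB) :
  (\sum_(a : TA) count_data D (fun s => (fA s, fB s)) (a, b) =
   count_data D fB b)%N.
Proof.
under eq_bigr do rewrite count_dataE.
rewrite count_dataE exchange_big/=; apply: eq_bigr => k _.
rewrite (bigD1 (fA (D k)))//= xpair_eqE eqxx big1 ?addn0// => a.
by rewrite xpair_eqE [fA _ == a]eq_sym => /negbTE->.
Qed.

End CountStatistics.

(** * The uniformity measure as a signed sum of squares *)

Section Uniformity.
Variables (R : realType) (TA TB TP : finType).

(** A marginal is constant in the variables it sums out, so [p] weighted by that marginal sums to
    the square of the marginal. The result has the shape that sums of squared counts produce. *)
Lemma uniformityE (p : TA -> TB -> TP -> R) :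
  uniformity p =
    (#|TA| * #|TB| * #|TP|)%:R * (\sum_a \sum_b \sum_pi p a b pi ^+ 2)
    - (#|TA| * #|TP|)%:R * (\sum_a \sum_pi (\sum_b p a b pi) ^+ 2)
    - (#|TB| * #|TP|)%:R * (\sum_b \sum_pi (\sum_a p a b pi) ^+ 2)
    + #|TP|%:R * (\sum_pi (\sum_a \sum_b p a b pi) ^+ 2).
Proof.
rewrite /uniformity.
have -> : \sum_a \sum_pi (\sum_b p a b pi) ^+ 2 =
    \sum_a \sum_b \sum_pi p a b pi * (\sum_b p a b pi).
  apply: eq_bigr => a _; rewrite exchange_big/=; apply: eq_bigr => pi _.
  by rewrite -mulr_suml expr2.
have -> : \sum_b \sum_pi (\sum_a p a b pi) ^+ 2 =
    \sum_a \sum_b \sum_pi p a b pi * (\sum_a p a b pi).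
  rewrite [RHS]exchange_big/=; apply: eq_bigr => b _.
  rewrite [RHS]exchange_big/=; apply: eq_bigr => pi _.
  by rewrite -mulr_suml expr2.
have -> : \sum_pi (\sum_a \sum_b p a b pi) ^+ 2 =
    \sum_a \sum_b \sum_pi p a b pi * (\sum_a \sum_b p a b pi).
  under [RHS]eq_bigr do rewrite exchange_big/=.
  rewrite [RHS]exchange_big/=; apply: eq_bigr => pi _.
  by rewrite expr2 mulr_suml; apply: eq_bigr => a _; rewrite mulr_suml.
rewrite !mulr_sumr -!sumrB -big_split/=; apply: eq_bigr => a _.
rewrite !mulr_sumr -!sumrB -big_split/=; apply: eq_bigr => b _.
rewrite !mulr_sumr -!sumrB -big_split/=; apply: eq_bigr => pi _.
ring.
Qed.

End Uniformity.

(** * Uniformity of the empirical distribution, and factorization of the marginal likelihood *)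

Section BDeu.
Variables (R : realType) (n : nat) (Omega : 'I_n -> finType).
Variables (N : nat) (D : 'I_N -> sample Omega).

(** The factor [N ^ 2] clears the denominators of the empirical frequencies, and the squared counts
    of each marginal sum to coincidences. *)
Lemma sqr_uniformity_empirical (A B : 'I_n) (Pi : {set 'I_n}) :
  N%:R ^+ 2 * uniformity (fun (a : Omega A) (b : Omega B) (pi : states Omega Pi) =>
     empirical D R a b pi) =
  (#|Omega A| * #|Omega B| * #|states Omega Pi|)%:R *
     (coincidences D (fun s => (s A, s B, restr Pi s)))%:R
  - (#|Omega A| * #|states Omega Pi|)%:R *
     (coincidences D (fun s => (s A, restr Pi s)))%:R
  - (#|Omega B| * #|states Omega Pi|)%:R *
     (coincidences D (fun s => (s B, restr Pi s)))%:R
  + #|states Omega Pi|%:R * (coincidences D (restr Pi))%:R :> R.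
Proof.
(* Without samples the frequencies are divisions by 0, but both sides vanish: the left through
   [N ^ 2], the right because there are no pairs of samples. *)
have [N0|N0] := eqVneq N 0.
  have C0 (T : eqType) (f : sample Omega -> T) : coincidences D f = 0%N.
    rewrite /coincidences big1// => k _.
    by have := ltn_ord k; rewrite {2}N0.
  by rewrite {1}N0 !C0 expr0n mul0r !mulr0 !subr0 addr0.
have NR : N%:R != 0 :> R by rewrite pnatr_eq0.
rewrite uniformityE mulrDr !mulrBr -!(mulrCA _ (N%:R ^+ 2)).
have NV (c : nat) : N%:R ^+ 2 * (c%:R / N%:R) ^+ 2 = (c ^ 2)%:R :> R.
  by rewrite natrX; field.
congr (_ * _ - _ * _ - _ * _ + _ * _).
- rewrite -sum_count_data_sqr natr_sum.
  rewrite -(pair_bigA _ (fun ab pi =>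
    (count_data D (fun s => (s A, s B, restr Pi s)) (ab, pi) ^ 2)%:R)).
  rewrite -(pair_bigA _ (fun a b => \sum_pi
    (count_data D (fun s => (s A, s B, restr Pi s)) (a, b, pi) ^ 2)%:R))/=.
  rewrite mulr_sumr; apply: eq_bigr => a _.
  rewrite mulr_sumr; apply: eq_bigr => b _.
  by rewrite mulr_sumr; apply: eq_bigr => pi _; exact: NV.
- rewrite -sum_count_data_sqr natr_sum.
  rewrite -(pair_bigA _ (fun a pi =>
    (count_data D (fun s => (s A, restr Pi s)) (a, pi) ^ 2)%:R))/=.
  rewrite mulr_sumr; apply: eq_bigr => a _.
  rewrite mulr_sumr; apply: eq_bigr => pi _.
  by rewrite -mulr_suml -natr_sum sum_count_data_mid NV.
- rewrite -sum_count_data_sqr natr_sum.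
  rewrite -(pair_bigA _ (fun b pi =>
    (count_data D (fun s => (s B, restr Pi s)) (b, pi) ^ 2)%:R))/=.
  rewrite mulr_sumr; apply: eq_bigr => b _.
  rewrite mulr_sumr; apply: eq_bigr => pi _.
  rewrite -mulr_suml -natr_sum -NV; congr (_ * (_%:R / _) ^+ 2).
  (* Summing out the first variable requires the triple nested as [(a, (b, pi))] instead of
     [((a, b), pi)]; the counts agree. *)
  rewrite -(sum_count_data_left D (fun s : sample Omega => s A)
    (fun s : sample Omega => (s B, restr Pi s)))/=.
  apply: eq_bigr => a _; rewrite !count_dataE.
  by apply: eq_bigr => k _; rewrite !xpair_eqE andbA.
- rewrite -sum_count_data_sqr natr_sum.
  rewrite mulr_sumr; apply: eq_bigr => pi _.
  rewrite -NV; congr (_ * _ ^+ 2).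
  rewrite -(sum_count_data_left D (fun s : sample Omega => s A)) natr_sum mulr_suml.
  apply: eq_bigr => a _.
  by rewrite -mulr_suml -natr_sum sum_count_data_mid.
Qed.

(** The factor of one variable; its parent Gammas occur inverted in BDeu, hence the quotient. *)
Definition local_score (alpha : R) (i : 'I_n) (P : {set 'I_n}) : R :=
  gamma_score D alpha (fun s => (s i, restr P s)) / gamma_score D alpha (restr P).

Lemma marginal_likelihoodE (alpha : R) (G : rel 'I_n) :
  marginal_likelihood D alpha G = \prod_(i < n) local_score alpha i (parents G i).
Proof.
apply: eq_bigr => i _; rewrite /local_score /gamma_score.
rewrite big_split/= mulrC; congr (_ * _); last first.
  by rewrite -prodfV; apply: eq_bigr => pi _; rewrite invf_div.
rewrite exchange_big/= pair_bigA/=; apply: eq_bigr => -[x pi] _ /=.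
by rewrite /bdeu_joint card_prod natrM.
Qed.

(** Reduces coincidence of restrictions to coordinates, so that a parent set enlarged by [B] can be
    compared with a pair of statistics. *)
Lemma restr_eq (Y : {set 'I_n}) (s s' : sample Omega) :
  (restr Y s == restr Y s') = [forall j in Y, s j == s' j].
Proof.
apply/eqP/forall_inP => [/ffunP E j jY|E].
  by have := E (Sub j jY); rewrite !ffunE/= => ->.
by apply/ffunP => j; rewrite !ffunE; apply/eqP/E/(valP j).
Qed.

Lemma card_statesE (Y : {set 'I_n}) : #|states Omega Y| = (\prod_(j in Y) #|Omega j|)%N.
Proof.
rewrite card_dep_ffun foldrE big_map big_enum/=.
by rewrite -(big_sub (mem Y) (fun j => #|Omega j|)).
Qed.

Lemma card_statesU1 (Y : {set 'I_n}) (B : 'I_n) : B \notin Y ->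
  #|states Omega (B |: Y)| = (#|Omega B| * #|states Omega Y|)%N.
Proof. by move=> BY; rewrite !card_statesE big_setU1. Qed.

End BDeu.

(** * Reduction of the Bayes factor to the variable [A], and assembly of the expansion *)

Section BayesFactor.
Variables (R : realType) (n : nat) (Omega : 'I_n -> finType).
Variables (N : nat) (D : 'I_N -> sample Omega).

Lemma local_score_gt0 (alpha : R) (i : 'I_n) (P : {set 'I_n}) :
  #|{: Omega i * states Omega P}|%:R < alpha -> #|states Omega P|%:R < alpha ->
  0 < local_score D alpha i P.
Proof. by move=> h1 h2; rewrite divr_gt0 ?gamma_score_gt0. Qed.

Lemma near_local_score_gt0 (i : 'I_n) (P : {set 'I_n}) :
  \forall alpha \near +oo_ R, 0 < local_score D alpha i P.
Proof.
near=> alpha; apply: local_score_gt0; near: alpha; exact: nbhs_pinfty_gt.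
Unshelve. all: by end_near. Qed.

(** Both likelihoods are the factor of [A] times the same product [P] over the other variables;
    positivity makes [P] nonzero, so it cancels. *)
Lemma marginal_likelihood_ratio (alpha : R) (Gp Gm : rel 'I_n) (A : 'I_n) :
  (forall i, i != A -> parents Gp i = parents Gm i) ->
  (forall i, 0 < local_score D alpha i (parents Gm i)) ->
  marginal_likelihood D alpha Gp / marginal_likelihood D alpha Gm =
  local_score D alpha A (parents Gp A) / local_score D alpha A (parents Gm A).
Proof.
move=> EG S0.
pose P := \prod_(i < n | i != A) local_score D alpha i (parents Gm i).
have P0 : P != 0 by apply: lt0r_neq0; apply: prodr_gt0 => i _; exact: S0.
have EP G : (forall i, i != A -> parents G i = parents Gm i) ->
    marginal_likelihood D alpha G = local_score D alpha A (parents G A) * P.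
  move=> EGm; rewrite marginal_likelihoodE (bigD1 A)//; congr (_ * _).
  by apply: eq_bigr => i /EGm ->.
rewrite (EP Gp EG) (EP Gm (fun _ _ => erefl)); clearbody P.
move: (local_score _ _ _ _) (local_score _ _ _ _) => x y.
by rewrite -mulf_div divff// mulr1.
Qed.

(* A variable without states would give [ln] a junk argument, but then [N = 0]. *)
Lemma ln_ess_cancel (alpha : R) (A B : 'I_n) (Pi : {set 'I_n}) : 0 < alpha ->
  N%:R * (ln (alpha / (#|Omega A| * (#|Omega B| * #|states Omega Pi|))%:R)
    - ln (alpha / (#|Omega B| * #|states Omega Pi|)%:R)
    - ln (alpha / (#|Omega A| * #|states Omega Pi|)%:R)
    + ln (alpha / #|states Omega Pi|%:R)) = 0.
Proof.
move=> a0; have [->|] := posnP N; first by rewrite mul0r.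
move=> N0; pose s := D (Ordinal N0).
have A0 : 0 < #|Omega A|%:R :> R by rewrite ltr0n; apply/card_gt0P; exists (s A).
have B0 : 0 < #|Omega B|%:R :> R by rewrite ltr0n; apply/card_gt0P; exists (s B).
have P0 : 0 < #|states Omega Pi|%:R :> R.
  by rewrite ltr0n; apply/card_gt0P; exists (restr Pi s).
by rewrite !natrM !ln_div ?lnM ?posrE ?mulr_gt0//; ring.
Qed.

End BayesFactor.

Theorem proposition2 (R : realType) (n : nat) (Omega : 'I_n -> finType)
    (N : nat) (D : 'I_N -> sample Omega)
    (Gp Gm : rel 'I_n) (A B : 'I_n)
    (Gp_acyclic : acyclic Gp) (Gm_acyclic : acyclic Gm)
    (Gp_edge : Gp B A) (Gm_nedge : ~~ Gm B A)
    (G_same : forall i j : 'I_n, (i, j) != (B, A) -> Gp i j = Gm i j) :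
  let Pi := parents Gm A in
  let U : R := uniformity (fun (a : Omega A) (b : Omega B) (pi : states Omega Pi) =>
                 empirical D R a b pi) in
  let dF : R := deg_freedom R (Omega A) (Omega B) (states Omega Pi) in
  exists C : R, \forall alpha \near +oo_ R,
    `| ln (marginal_likelihood D alpha Gp / marginal_likelihood D alpha Gm)
       - N%:R / (2 * alpha) * (N%:R * U - dF) |
    <= C * (N%:R ^+ 2 / alpha ^+ 2).
Proof.
move=> Pi U dF.
have BPi : B \notin Pi by rewrite inE.
have parA : parents Gp A = B |: Pi.
  apply/setP => j; rewrite !inE; have [->//|jB] := eqVneq j B.
  by rewrite G_same// xpair_eqE (negbTE jB).
have parD i : i != A -> parents Gp i = parents Gm i.
  by move=> iA; apply/setP => j; rewrite !inE G_same// xpair_eqE (negbTE iA) andbF.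
pose a : R := #|Omega A|%:R; pose b : R := #|Omega B|%:R.
pose q : R := #|states Omega Pi|%:R.
(* The sum of the four error coefficients [#|T|^2 * N] from [ln_gamma_score], one for each
   statistic. The constant thus depends on the sample size and the state counts, not on [alpha]. *)
exists (N%:R * ((a * (b * q)) ^+ 2 + (b * q) ^+ 2 + (a * q) ^+ 2 + q ^+ 2)).
near=> alpha.
have alpha0 : 0 < alpha by near: alpha; exact: nbhs_pinfty_gt.
have Gm0 i : 0 < local_score D alpha i (parents Gm i).
  (* There are finitely many variables, so the eventual positivity holds for all of them at once. *)
  by move: i; near: alpha; apply: filter_forall => i; exact: near_local_score_gt0.
rewrite (marginal_likelihood_ratio parD Gm0) parA -/Pi.
have lt1 : #|{: Omega A * states Omega (B |: Pi)}|%:R < alpha.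
  by near: alpha; exact: nbhs_pinfty_gt.
have lt2 : #|states Omega (B |: Pi)|%:R < alpha.
  by near: alpha; exact: nbhs_pinfty_gt.
have lt3 : #|{: Omega A * states Omega Pi}|%:R < alpha.
  by near: alpha; exact: nbhs_pinfty_gt.
have lt4 : #|states Omega Pi|%:R < alpha by near: alpha; exact: nbhs_pinfty_gt.
rewrite !ln_div ?posrE ?local_score_gt0 ?gamma_score_gt0//.
have := ln_gamma_score D (fun s => (s A, restr (B |: Pi) s)) lt1.
have := ln_gamma_score D (restr (B |: Pi)) lt2.
have := ln_gamma_score D (fun s => (s A, restr Pi s)) lt3.
have := ln_gamma_score D (restr Pi) lt4.
(* States of [B |: Pi] are not literally pairs, but they separate samples exactly as pairs of a
   state of [B] and a state of [Pi] do, so the coincidences agree. *)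
have restrU1 (s s' : sample Omega) : (restr (B |: Pi) s == restr (B |: Pi) s') =
    (s B == s' B) && (restr Pi s == restr Pi s').
  rewrite !restr_eq; apply/forall_inP/andP => [E|[EB /forall_inP E] j].
    split; first by apply: E; rewrite setU11.
    by apply/forall_inP => j jP; apply: E; rewrite setU1r.
  by case/setU1P => [->//|]; exact: E.
rewrite (@eq_coincidences _ _ _ D _ _ (fun s => (s A, restr (B |: Pi) s))
  (fun s => (s A, s B, restr Pi s))); last first.
  by move=> s s'; rewrite !xpair_eqE restrU1 andbA.
rewrite (@eq_coincidences _ _ _ D _ _ (restr (B |: Pi))
  (fun s => (s B, restr Pi s))); last by move=> s s'; rewrite restrU1.
rewrite !card_prod !card_statesU1//.
have := ln_ess_cancel D A B Pi alpha0.
have := sqr_uniformity_empirical R D A B Pi.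
rewrite -/U !natrM -/a -/b -/q.
rewrite /dF /deg_freedom -/a -/b -/q.
set l1 := ln (alpha / (a * (b * q))); set l2 := ln (alpha / (b * q)).
set l3 := ln (alpha / (a * q)); set l4 := ln (alpha / q).
set g1 := ln (gamma_score _ _ (fun s => (s A, restr (B |: Pi) s))).
set g2 := ln (gamma_score _ _ (restr (B |: Pi))).
set g3 := ln (gamma_score _ _ (fun s => (s A, restr Pi s))).
set g4 := ln (gamma_score _ _ (restr Pi)).
set c1 := (coincidences _ (fun s => (s A, s B, restr Pi s)))%:R.
set c2 := (coincidences _ (fun s => (s B, restr Pi s)))%:R.
set c3 := (coincidences _ (fun s => (s A, restr Pi s)))%:R.
set c4 := (coincidences _ (restr Pi))%:R.
move=> EU El.
set E4 := (X in `|X| <= _ -> _); set E3 := (X in _ -> `|X| <= _ -> _).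
set E2 := (X in _ -> _ -> `|X| <= _ -> _); set E1 := (X in _ -> _ -> _ -> `|X| <= _ -> _).
move=> H4 H3 H2 H1.
(* The error of the theorem is the signed sum of the four expansion errors: the [ln] terms cancel by
   [El], the coincidences match [U] by [EU], and [a * b * q - b * q - a * q + q = q * (a - 1) * (b -
   1)] turns the linear terms into the degrees of freedom. *)
have -> : g1 - g2 - (g3 - g4) - N%:R / (2 * alpha) * (N%:R * U - q * (a - 1) * (b - 1))
    = (E1 - E2) - (E3 - E4).
  apply/eqP; rewrite -subr_eq0; apply/eqP.
  transitivity (N%:R * (l1 - l2 - l3 + l4) - (2 * alpha)^-1 * (N%:R ^+ 2 * U -
     (a * b * q * c1 - a * q * c3 - b * q * c2 + q * c4))).
    by rewrite /E1 /E2 /E3 /E4; field; rewrite gt_eqF.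
  by rewrite El EU subrr mulr0 subr0.
rewrite (le_trans (ler_normB _ _))//.
rewrite (le_trans (lerD (ler_normB _ _) (ler_normB _ _)))//.
rewrite (le_trans (lerD (lerD H1 H2) (lerD H3 H4)))//.
by rewrite le_eqVlt; apply/predU1P; left; ring.
Unshelve. all: by end_near. Qed.
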